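(* Let $G$ be a connected $3K_1$-free graph and let $u\in V(G)$. Then $G$ has a Hamiltonian path starting at $u$ (i.e., having $u$ as an end-vertex) if and only if $u$ is not an articulation point of $G$.
   Context: Graphs are finite, simple and undirected. A graph is $3K_1$-free if it contains no three pairwise non-adjacent vertices. A Hamiltonian path is a path containing all vertices of the graph. An articulation point of $G$ is a vertex $x$ such that $G-\{x\}$ is disconnected. *)

(* Defs.v *)
(* MathComp *)
From mathcomp Require Import all_boot.

Set Implicit Arguments.
Unset Strict Implicit.
Unset Printing Implicit Defensive.

(* A finite simple undirected graph is given by its vertex set [T : finType]   *)
(* and a symmetric irreflexive adjacency relation [e : rel T].                 *)

Definition simple_graph (T : finType) (e : rel T) : Prop :=
  symmetric e /\ irreflexive e.

(* The graph without vertices counts as connected, so the vertex of the        *)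
(* one-vertex graph is not an articulation point.                              *)
Definition connected (T : finType) (e : rel T) : bool :=
  [forall x, forall y, connect e x y].

Definition three_K1_free (T : finType) (e : rel T) : Prop :=
  ~ exists x y z : T,
      [/\ uniq [:: x; y; z], ~~ e x y, ~~ e x z & ~~ e y z].

(* The graph G - {x}, on the subtype of vertices other than [x].               *)
Definition del_vertex (T : finType) (e : rel T) (x : T) :
    rel {y : T | y != x} :=
  [rel a b | e (val a) (val b)].
Arguments del_vertex {T} e x.

Definition articulation_point (T : finType) (e : rel T) (x : T) : bool :=
  ~~ connected (del_vertex e x).

Definition hamiltonian_path (T : finType) (e : rel T) (s : seq T) : Prop :=
  [/\ sorted e s, uniq s & forall x : T, x \in s].

(* Main.v *)
(** Rotation-extension argument.  Let [u = p_0, ..., p_k] be a path missing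
    some vertex, such that [p_k] has no neighbour off the path.  As [G - u] is
    connected, some [p_i] with [i >= 1] is adjacent to a vertex [r] off the
    path.  If [p_(i-1)] is adjacent to [r], insert [r] between [p_(i-1)] and
    [p_i]; otherwise [p_(i-1)] is adjacent to [p_k], since [p_(i-1)], [p_k],
    [r] are not independent, and
    [p_0, ..., p_(i-1), p_k, p_(k-1), ..., p_i, r] is a longer path. *)
Require Import Defs.
From mathcomp Require Import all_boot.

Lemma connect_exit (T : finType) (e : rel T) (A : pred T) (x y : T) :
  connect e x y -> A x -> ~~ A y -> exists a b, [/\ A a, ~~ A b & e a b].
Proof.
case/connectP=> p; elim: p x => [|z p IHp] x /=; first by move=> _ -> ->.
case/andP=> exz ezp y_last Ax nAy.
have [Az|nAz] := boolP (A z); first exact: IHp ezp y_last Az nAy.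
by exists x, z.
Qed.

(** The rotated part of the path: from [z] jump to the far end of [y :: s], walk it backwards, which
    symmetry allows, and leave through its first vertex [y]. *)
Lemma path_rcons_rev (T : eqType) (e : rel T) (z y r : T) (s : seq T) :
  symmetric e -> path e y s -> e z (last y s) -> e y r ->
  path e z (rcons (rev (y :: s)) r).
Proof.
move=> sym_e eys ezl eyr.
have erev : path e (last y s) (rev (belast y s)).
  by rewrite rev_path; under eq_path do rewrite /= sym_e.
have rev_ys : rev (y :: s) = last y s :: rev (belast y s).
  by rewrite lastI rev_rcons.
have last_rev : last z (rev (y :: s)) = y by rewrite rev_cons last_rcons.
by rewrite rcons_path last_rev eyr andbT rev_ys /= ezl.
Qed.

Lemma path_extend (T : finType) (e : rel T) (u x : T) (p : seq T) :
  symmetric e -> connected e -> three_K1_free e ->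
  connected (del_vertex e u) ->
  path e u p -> uniq (u :: p) -> x \notin u :: p ->
  exists q, [/\ path e u q, uniq (u :: q) & size q = (size p).+1].
Proof.
move=> sym_e conn_e free_e conn_u eup uniq_p xNp.
(* Uniqueness and length survive permutation, so each construction below owes only a path from [u]
   and a rearrangement of [r :: p]. *)
have perm_extend q r : r \notin u :: p -> perm_eq q (r :: p) -> path e u q ->
    exists q, [/\ path e u q, uniq (u :: q) & size q = (size p).+1].
  move=> rNp perm_q euq; exists q; split=> //; last exact: perm_size perm_q.
  have perm_uq : perm_eq (u :: q) (r :: u :: p).
    by rewrite perm_sym -(cat1s r) -(cat1s u p) perm_catCA /= perm_cons perm_sym.
  by rewrite (perm_uniq perm_uq) cons_uniq rNp.
have [/existsP[r /andP[rNp elr]]|no_ext] :=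
    boolP [exists r, (r \notin u :: p) && e (last u p) r].
  apply: (perm_extend (rcons p r) r) => //; first by rewrite perm_rcons.
  by rewrite rcons_path eup.
have lastN r : r \notin u :: p -> ~~ e (last u p) r.
  move=> rNp; apply: contra no_ext => elr.
  by apply/existsP; exists r; rewrite rNp.
(* Asking for [y] in [p] rather than in [u :: p] ensures that [y] has a predecessor on the path. *)
have [y [r [yp rNp eyr]]] : exists y r, [/\ y \in p, r \notin u :: p & e y r].
  (* If [p] is empty, then [u] is itself the last vertex; connectivity of the whole graph gives it a
     neighbour off the path, against [lastN]. *)
  case: p eup uniq_p xNp lastN {perm_extend no_ext} => [|h p] eup uniq_p xNp lastN.
    have eux : connect e u x by move/forallP: conn_e => /(_ u)/forallP/(_ x).
    have [|a [b [/= /eqP-> bNu eub]]] := @connect_exit _ _ (pred1 u) _ _ eux (eqxx u).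
      by move: xNp; rewrite inE.
    by move: (lastN b); rewrite inE /= eub => /(_ bNu).
  have hNu : h != u.
    by apply: contraTneq uniq_p => ->; rewrite /= inE eqxx.
  have xNu : x != u by apply: contraNneq xNp => ->; rewrite inE eqxx.
  (* A walk from [h] to [x] avoiding [u] must leave [h :: p] somewhere. *)
  move/forallP: conn_u => /(_ (Sub h hNu))/forallP/(_ (Sub x xNu)) ehx.
  have [||a [b [/= ap bNp eab]]] :=
      @connect_exit _ _ [pred a | val a \in h :: p] _ _ ehx.
  - by rewrite /= inE eqxx.
  - by move: xNp; rewrite in_cons negb_or => /andP[].
  by exists (val a), (val b); split=> //; rewrite in_cons negb_or bNp (valP b).
(* The predecessor of [y] is now [last u p1], which is [u] itself when [p1] is empty. *)
case/splitPr: yp eup uniq_p rNp lastN perm_extend {xNp no_ext} => p1 p2.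
rewrite cat_path last_cat /= => /and3P[eup1 ezy eyp2] uniq_p rNp lastN ext.
have [ezr|nezr] := boolP (e (last u p1) r).
  apply: (ext (p1 ++ r :: y :: p2) r) => //.
    by rewrite -(cat1s r (y :: p2)) perm_catCA.
  by rewrite cat_path /= eup1 ezr sym_e eyr.
have uniq_split : uniq ((u :: p1) ++ y :: p2) by [].
have zp1 : last u p1 \in u :: p1 by exact: mem_last.
have lp2 : last y p2 \in y :: p2 by exact: mem_last.
have z_neq_l : last u p1 != last y p2.
  apply/eqP=> zl; move: uniq_split; rewrite cat_uniq => /and3P[_ /hasPn disj _].
  by move: (disj _ lp2); rewrite -zl /= zp1.
have rN v : v \in (u :: p1) ++ y :: p2 -> v != r.
  by move=> vp; apply: contraNneq rNp => <-.
have ezl : e (last u p1) (last y p2).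
  apply/negPn/negP => nezl; apply: free_e.
  exists (last u p1), (last y p2), r; split=> //; last exact: lastN.
  by rewrite /= !inE negb_or z_neq_l !rN // mem_cat ?zp1 ?lp2 ?orbT.
apply: (ext (p1 ++ rcons (rev (y :: p2)) r) r) => //; last first.
  by rewrite cat_path eup1 path_rcons_rev.
by rewrite -rcons_cat perm_rcons perm_cons perm_cat2l perm_rev.
Qed.

Lemma hamiltonian_path_exists (T : finType) (e : rel T) (u : T) :
  symmetric e -> connected e -> three_K1_free e ->
  connected (del_vertex e u) -> exists p, hamiltonian_path e (u :: p).
Proof.
move=> sym_e conn_e free_e conn_u.
(* Here [n] bounds the number of further extensions; at [n = 0] the path [u :: p] would have more
   than [#|T|] distinct vertices. *)
suff grow n p : path e u p -> uniq (u :: p) -> #|T| <= size p + n ->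
    exists p, hamiltonian_path e (u :: p).
  exact: (grow #|T| [::]).
elim: n p => [|n IHn] p eup uniq_p size_p.
  by have := uniq_leq_size uniq_p (fun x _ => mem_enum T x);
    rewrite -cardT /= ltnNge -(addn0 (size p)) size_p.
have [/forallP all_p|] := boolP [forall x, x \in u :: p]; first by exists p.
rewrite negb_forall => /existsP[x xNp].
have [q [euq uniq_q size_q]] :=
  @path_extend _ _ _ _ _ sym_e conn_e free_e conn_u eup uniq_p xNp.
by apply: IHn euq uniq_q _; rewrite size_q addSnnS.
Qed.

(** Dropping the initial [u] leaves a path through all of $G - u$, so its first vertex reaches every
    other; if nothing remains, $G - u$ is empty and counts as connected. *)
Lemma hamiltonian_path_del_connected (T : finType) (e : rel T) (u : T) p :
  symmetric e -> hamiltonian_path e (u :: p) -> connected (del_vertex e u).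
Proof.
move=> sym_e [/= eup /andP[uNp _] all_p].
have [s def_p] : exists s : seq {y | y != u}, p = map val s.
  exists (pmap insub p); rewrite pmap_filter; last exact: insubK.
  apply/esym/all_filterP/allP => x xp; rewrite isSome_insub.
  by apply: contraNneq uNp => <-.
have mem_s a : a \in s.
  have := all_p (val a); rewrite inE (negPf (valP a)) def_p.
  by rewrite (mem_map val_inj).
have sym_u : symmetric (del_vertex e u) by move=> a b; apply: sym_e.
case: s def_p mem_s => [|h s] def_p mem_s.
  by apply/forallP=> a; have := mem_s a.
have ehs : path (del_vertex e u) h s.
  by move: eup; rewrite def_p /= path_map => /andP[].
have connh a : connect (del_vertex e u) h a.
  exact: (path_connect ehs).
apply/forallP=> a; apply/forallP=> b.
by apply: connect_trans (connh b); rewrite sym_connect_sym.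
Qed.

Theorem theorem2 (T : finType) (e : rel T) (u : T)
    (simple_e : simple_graph e) (connected_e : connected e)
    (free_e : three_K1_free e) :
  (exists p : seq T, hamiltonian_path e (u :: p)) <-> ~~ articulation_point e u.
Proof.
case: simple_e => sym_e _; rewrite negbK; split.
  by case=> p; apply: hamiltonian_path_del_connected.
exact: hamiltonian_path_exists.
Qed.
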